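(* Let $\lambda$ be a strict partition and let \[ W_{\lambda}^Q=\left\{\boldsymbol s=(s_{ij})\in ST(\lambda,\mathbb{C})\ \middle|\ \Re(s_{ij})\ge 1 \text{ for all } (i,j)\in SD(\lambda)\setminus SC(\lambda),\ \ \Re(s_{ij})>1 \text{ for all } (i,j)\in SC(\lambda)\right\}. \] If $\boldsymbol s\in W_\lambda^Q$, then both series \[ \zeta_\lambda^P(\boldsymbol s)=\sum_{M\in PSST(\lambda)}\frac{1}{M^{\boldsymbol s}},\qquad \zeta_\lambda^Q(\boldsymbol s)=\sum_{M\in QSST(\lambda)}\frac{1}{M^{\boldsymbol s}} \] converge absolutely.
   Context: A partition $\lambda=(\lambda_1,\ldots,\lambda_r)$ is strict if $\lambda_1>\lambda_2>\cdots>\lambda_r\ge 0$. Its shifted diagram is $SD(\lambda)=\{(i,j)\in\mathbb Z^2 : 1\le i\le r,\ i\le j\le \lambda_i+i-1\}$ (row index $i$ increasing downwards, column index $j$ increasing to the right). A box $(i,j)\in SD(\lambda)$ is a corner if $(i+1,j)\notin SD(\lambda)$ and $(i,j+1)\notin SD(\lambda)$; $SC(\lambda)$ is the set of corners. $ST(\lambda,X)$ is the set of fillings $(t_{ij})_{(i,j)\in SD(\lambda)}$ with $t_{ij}\in X$. Let $\mathbb N'=\{1',1,2',2,\ldots\}$ with total order $1'<1<2'<2<\cdots$, and put $|i|=|i'|=i$. $QSST(\lambda)$ is the set of $(m_{ij})\in ST(\lambda,\mathbb N')$ such that the entries are weakly increasing along each row (left to right) and each column (top to bottom), for each $i=1,2,\ldots$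 there is at most one $i'$ in each row, and for each $i$ there is at most one $i$ in each column. $PSST(\lambda)$ is the subset of those having no primed entry on the main diagonal (boxes $(i,i)$). For $M=(m_{ij})$ put $M^{\boldsymbol s}=\prod_{(i,j)\in SD(\lambda)}|m_{ij}|^{s_{ij}}$. *)

(* Defs.v *)
From HB Require Import structures.
From mathcomp Require Import all_boot all_order all_algebra.
From mathcomp Require Import all_classical all_reals all_analysis.
From mathcomp Require Export complex.

Set Implicit Arguments.
Unset Strict Implicit.
Unset Printing Implicit Defensive.

Import Order.TTheory GRing.Theory Num.Theory.

Definition strict_partition (lam : seq nat) : bool := sorted gtn lam.

(* A box is a pair (row, column), both counted from 1; the part lambda_i is
   therefore [nth 0 lam i.-1]. *)
Definition SD (lam : seq nat) : seq (nat * nat) :=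
  [seq (i, j) | i <- iota 1 (size lam), j <- iota i (nth 0 lam i.-1)].

Lemma mem_SD (lam : seq nat) (i j : nat) :
  ((i, j) \in SD lam) =
  (1 <= i <= size lam) && (i <= j <= nth 0 lam i.-1 + i - 1).
Proof.
apply/allpairsPdep/andP => [[i' [j' [+ + [-> ->]]]]|[Hi Hj]].
  rewrite !mem_iota add1n ltnS => /andP[i0 ->] /andP[-> jlt].
  by rewrite i0 addnC subn1 -ltnS prednK ?(leq_ltn_trans _ jlt).
exists i, j; rewrite !mem_iota add1n ltnS; split=> //.
case/andP: Hi => i0 _; case/andP: Hj => -> /=.
by rewrite subn1 addnC -ltnS prednK // addn_gt0 i0.
Qed.

Definition SC (lam : seq nat) : pred (nat * nat) :=
  fun b => [&& b \in SD lam, (b.1.+1, b.2) \notin SD lam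
             & (b.1, b.2.+1) \notin SD lam].

Definition box (lam : seq nat) : finType := seq_sub (SD lam).

Definition box_row lam (b : box lam) : nat := (val b).1.
Definition box_col lam (b : box lam) : nat := (val b).2.

Definition ST (lam : seq nat) (X : Type) : Type := {ffun box lam -> X}.

(* The alphabet 1' < 1 < 2' < 2 < ...: the pair (k, b) stands for k+1 if
   b = true and for (k+1)' if b = false.  As false < true, the lexicographic
   order is the order of the alphabet. *)
Definition primed_nat := (nat *l bool)%type.
Definition primed (k : nat) : primed_nat := (k.-1, false).
Definition unprimed (k : nat) : primed_nat := (k.-1, true).
Definition is_primed (m : primed_nat) : bool := ~~ m.2.
Definition pabs (m : primed_nat) : nat := m.1.+1.

Local Open Scope classical_set_scope.
Local Open Scope order_scope.

Definition QSST (lam : seq nat) : set (ST lam primed_nat) :=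
  [set M : ST lam primed_nat |
   [/\ (forall a b, box_row a = box_row b -> (box_col a <= box_col b)%N ->
          M a <= M b),
       (forall a b, box_col a = box_col b -> (box_row a <= box_row b)%N ->
          M a <= M b),
       (forall k, (1 <= k)%N -> forall a b, box_row a = box_row b ->
          M a = primed k -> M b = primed k -> a = b)
     & (forall k, (1 <= k)%N -> forall a b, box_col a = box_col b ->
          M a = unprimed k -> M b = unprimed k -> a = b)]].

Definition PSST (lam : seq nat) : set (ST lam primed_nat) :=
  [set M : ST lam primed_nat |
   QSST M /\ forall b, box_row b = box_col b -> ~~ is_primed (M b)].

Local Open Scope ring_scope.
Local Open Scope complex_scope.

Section Zeta.
Variable R : realType.

Definition cexp (z : R[i]) : R[i] :=
  (expR (complex.Re z))%:C * (cos (complex.Im z) +i* sin (complex.Im z)).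

(* n ^ s = exp (s log n), meant for n >= 1 *)
Definition natcpow (n : nat) (s : R[i]) : R[i] := cexp (s * (ln n%:R)%:C).

Definition weight (lam : seq nat) (M : ST lam primed_nat) (s : ST lam R[i]) :
  R[i] := \prod_(b : box lam) natcpow (pabs (M b)) (s b).

Definition WQ (lam : seq nat) : set (ST lam R[i]) :=
  [set s | (forall b : box lam, ~~ SC lam (val b) -> 1 <= complex.Re (s b)) /\
           (forall b : box lam, SC lam (val b) -> 1 < complex.Re (s b))].

Definition converges_absolutely (T : choiceType) (D : set T) (f : T -> R[i]) :
  Prop := (\esum_(x in D) (Normc.normc (f x))%:E < +oo)%E.

End Zeta.

(* Main.v *)
Require Import Defs.
From mathcomp Require Import all_boot all_order all_algebra.
From mathcomp Require Import all_classical all_reals all_analysis.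
From mathcomp Require Import lra.

(** For a single variable the series over k of k^-(1+d) converges as soon as
    d > 0, so a sum over arbitrary fillings of a finite diagram of the product
    of |m_b|^-(1+d) converges too: it is a power of the one-variable sum.  The
    point is that the weights here have exponent 1, with no excess, at all
    boxes but the corners, and fillings must be restricted to monotone ones.

    The excess at the corners can be redistributed.  Moving right or down
    inside the diagram ends at a corner, and entries of a tableau weakly
    increase on the way, so every |m_b| is at most some |m_c| with c a corner
    ([QSST_le_corner]).  If all corners have real part at least 1 + e, taking
    logarithms gives, with N boxes and d = e / (N + 1),
      sum_b Re(s_b) ln |m_b| >= (1 + d) sum_b ln |m_b|
    ([distribute_excess]): each ln |m_b| is at most the sum of the ln |m_c|
    over corners, hence e times the latter sum pays for a surplus d at each of
    the N boxes.  Therefore |M^-s| is at most the product of the |m_b|^-(1+d)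
    ([QSST_majorant]), and the monotonicity condition can be dropped
    ([esum_ffun_prod_lty]).  The two marks on each integer only double the
    one-variable sum ([esum_letters_lty]).  Since P-tableaux are Q-tableaux,
    one bound serves both series. *)

Import Order.TTheory GRing.Theory Num.Theory.

Local Open Scope classical_set_scope.
Local Open Scope ring_scope.

Lemma fsbig_finType (R : Type) (idx : R) (op : Monoid.com_law idx)
    (I : finType) (F : I -> R) :
  \big[op/idx]_(i \in [set: I]) F i = \big[op/idx]_(i : I) F i.
Proof.
rewrite [RHS](fsbig_seq _ _ (index_enum_uniq I)).
suff -> : [set` index_enum I] = [set: I] by [].
by apply/seteqP; split=> // i _; apply: mem_index_enum.
Qed.

Section RiemannSeries.
Context {R : realType}.
Implicit Types d : R.

Lemma riemannRE (a : R) n : riemannR a n = expR (- (a * ln n.+1%:R)).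
Proof. by rewrite /riemannR /powR pnatr_eq0 /= expRN. Qed.

(** A discrete form of the fact that x^-(1+d) is the derivative of -d^-1 x^-d.
    It follows from ln x <= ln y - 1/y for y = x + 1, and exp z >= 1 + z. *)
Lemma riemannR_telescope d n : 0 < d ->
  riemannR (1 + d) n.+1 <= d^-1 * (riemannR d n - riemannR d n.+1).
Proof.
move=> d0.
set x : R := n.+1%:R; set y : R := n.+2%:R.
have x0 : 0 < x by rewrite ltr0n.
have y0 : 0 < y by rewrite ltr0n.
have yE : y = x + 1 by rewrite /y /x -natr1.
have lnxy : ln x <= ln y - y^-1.
  have /le_ln1Dx : -1 < x / y - 1 by rewrite ltrBrDr addNr divr_gt0.
  rewrite addrC subrK ln_div ?posrE //.
  have -> : x / y - 1 = - y^-1.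
    by rewrite -[X in _ - X](divff (lt0r_neq0 y0)) -mulrBl yE opprD addNKr mulN1r.
  by rewrite lerBlDr addrC.
have step : riemannR d n.+1 * (1 + d / y) <= riemannR d n.
  rewrite !riemannRE -/x -/y.
  apply: (@le_trans _ _ (expR (- (d * ln y)) * expR (d / y))).
    by rewrite ler_wpM2l ?expR_ge0 ?expR_ge1Dx.
  by rewrite -expRD ler_expR lerNr opprD opprK -mulrBr ler_pM2l.
have -> : riemannR (1 + d) n.+1 = riemannR d n.+1 / y.
  rewrite !riemannRE -/y mulrDl mul1r opprD expRD mulrC; congr (_ * _).
  by rewrite expRN lnK.
rewrite -(ler_pM2l d0) mulVKf ?gt_eqF // lerBrDr.
by apply: le_trans step; rewrite mulrDr mulr1 addrC mulrCA.
Qed.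

(** The first term is 1, and the others telescope to at most d^-1. *)
Lemma series_riemannR_le d n : 0 < d ->
  \sum_(0 <= k < n) riemannR (1 + d) k <= 1 + d^-1.
Proof.
move=> d0.
have d1_ge0 : 0 <= d^-1 by rewrite invr_ge0 ltW.
case: n => [|n]; first by rewrite big_nil addr_ge0.
apply: (@le_trans _ _ (1 + d^-1 * (1 - riemannR d n))); last first.
  by rewrite lerD2l ler_piMr // lerBlDr lerDl ltW // riemannR_gt0 // ltW.
(* the telescoped bound retains the negative term, for the induction *)
elim: n => [|n IHn].
  by rewrite big_nat1 !riemannRE ln1 !mulr0 oppr0 expR0 subrr mulr0 addr0.
rewrite big_nat_recr //=; have := @riemannR_telescope d n d0.
rewrite !mulrBr; rewrite !mulrBr in IHn; lra.
Qed.

Local Open Scope ereal_scope.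

Lemma esum_letters_lty (d : R) : (0 < d)%R ->
  \esum_(m in [set: primed_nat]) (riemannR (1 + d) m.1)%:E < +oo.
Proof.
move=> d0; have r0 k : 0 <= (riemannR (1 + d) k)%:E.
  by rewrite lee_fin ltW // riemannR_gt0 // addr_ge0 // ltW.
pose J (k : nat) := [set: bool].
have -> : [set: primed_nat] = [set: nat] `*`` J by apply/seteqP; split.
rewrite -(@esum_esum R _ _ _ J (fun k _ => (riemannR (1 + d) k)%:E)) //.
rewrite (eq_esum (b := fun k => (2 * riemannR (1 + d) k)%:E)); last first.
  move=> k _; rewrite esum_fset //; last by apply: finite_finset.
  by rewrite fsbig_finType sumEFin big_bool /= -mulr2n mulr_natl.
rewrite -nneseries_esumT; last first.
  by move=> k; rewrite EFinM mule_ge0.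
apply: (@le_lt_trans _ _ (2 * (1 + d^-1))%:E); last exact: ltry.
apply: lime_le.
  apply: is_cvg_nneseries => k _ _; by rewrite EFinM mule_ge0.
apply: nearW => n; rewrite sumEFin lee_fin -mulr_sumr ler_pM2l //.
exact: series_riemannR_le.
Qed.

End RiemannSeries.

Section SumOverFunctions.
Context {R : realType} (I : finType) (T : choiceType).
Local Open Scope ereal_scope.

(** A finite set of functions takes only finitely many values, so it sits among
    the functions into a finite type J of values.  Over all of those the sum
    factors as the #|I|-th power of a sum over J, which is at most the total
    sum of a. *)
Lemma esum_ffun_prod_lty (D : set {ffun I -> T}) (a : T -> R) :
  (forall t, 0 <= a t)%R ->
  \esum_(t in [set: T]) (a t)%:E < +oo ->
  \esum_(f in D) (\prod_i a (f i))%:E < +oo.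
Proof.
move=> a0 aoo; set S := esum _ _ in aoo.
have S0 : 0 <= S by apply: esum_ge0 => t _; rewrite lee_fin.
have Sfin : S \is a fin_num by rewrite ge0_fin_numE.
apply: (@le_lt_trans _ _ (fine S ^+ #|I|)%:E); last exact: ltry.
apply: ge_ereal_sup => _ [X [finX _] <-].
have [fs XE] := iffLR (finite_seqP X) finX.
pose r : seq T := [seq (f : {ffun I -> T}) i | f <- fs, i <- enum I].
pose J : finType := seq_sub r.
pose g (h : {ffun I -> J}) : {ffun I -> T} := [ffun i => val (h i)].
have g_inj : injective g.
  move=> h1 h2 /ffunP eqg; apply/ffunP => i; apply: val_inj.
  by have := eqg i; rewrite !ffunE.
have Xg : X `<=` g @` [set: {ffun I -> J}].
  move=> f Xf.
  have fr i : f i \in r.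
    apply/allpairsP; exists (f, i); split => //=.
      by move: Xf; rewrite XE.
    by rewrite mem_enum.
  exists [ffun i => SeqSub (fr i)] => //.
  by apply/ffunP => i; rewrite !ffunE.
apply: (@le_trans _ _ (\sum_(f \in g @` [set: {ffun I -> J}])
                           (\prod_i a (f i))%:E)).
  apply: lee_fsum_nneg_subset => //.
  - by apply: finite_image; apply: finite_finset.
  - by move=> f; rewrite !inE; apply: Xg.
  - by move=> f _; rewrite lee_fin prodr_ge0.
rewrite fsbig_image; last by move=> h1 h2 _ _; apply: g_inj.
rewrite fsumEFin; last by apply: finite_finset.
rewrite lee_fin.
rewrite fsbig_finType.
under eq_bigr do under eq_bigr do rewrite ffunE.
rewrite -(bigA_distr_bigA (fun _ j => a (val j))) prodr_const.
apply: lerXn2r; rewrite ?nnegrE ?sumr_ge0 ?fine_ge0 //.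
rewrite -lee_fin fineK //.
apply: esum_ge.
exists [set` [seq val j | j : J]]; first by split.
rewrite -fsbig_seq; last by rewrite map_inj_uniq ?enum_uniq //; apply: val_inj.
by rewrite big_map sumEFin big_enum.
Qed.

End SumOverFunctions.

Section Excess.
Context {R : realFieldType} (I : finType).

(** The excess e available on P spreads evenly over all of I, because each x b
    is bounded by the sum Y of the x c with P c.  The successor in #|I|.+1
    only avoids dividing by zero when I is empty. *)
Lemma distribute_excess (P : pred I) (e : R) (x sigma : I -> R) :
  0 <= e -> (forall b, 0 <= x b) -> (forall b, 1 <= sigma b) ->
  (forall c, P c -> 1 + e <= sigma c) ->
  (forall b, exists2 c, P c & x b <= x c) ->
  (1 + e / #|I|.+1%:R) * \sum_b x b <= \sum_b sigma b * x b.
Proof.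
move=> e0 x0 s1 sP dom; set Y := \sum_(c | P c) x c.
have Y0 : 0 <= Y by apply: sumr_ge0.
have xY b : x b <= Y.
  have [c Pc /le_trans] := dom b; apply.
  by rewrite /Y (bigD1 c) //= lerDl sumr_ge0.
have sumxY : \sum_b x b <= #|I|.+1%:R * Y.
  apply: (@le_trans _ _ (\sum_(b : I) Y)); first exact: ler_sum.
  by rewrite sumr_const mulr_natl mulrS lerDr.
apply: (@le_trans _ _ (\sum_b x b + e * Y)).
  rewrite mulrDl mul1r lerD2l -mulrA ler_wpM2l //.
  by rewrite ler_pdivrMl ?ltr0n.
rewrite /Y mulr_sumr [X in _ + X]big_mkcond -big_split; apply: ler_sum => b _ /=.
case: ifP => [/sP sb|_]; last by rewrite addr0 ler_peMl.
by rewrite -[X in X + _]mul1r -mulrDl ler_wpM2r.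
Qed.

End Excess.

Section Tableaux.
Context {R : realType} (lam : seq nat).

Lemma pabs_homo (m n : primed_nat) : (m <= n)%O -> (pabs m <= pabs n)%N.
Proof.
by case: m n => [m1 m2] [n1 n2]; rewrite lexi_pair => /andP[].
Qed.

(** Among the boxes with entry at least M b, one that is furthest along
    row + column must be a corner: a right or lower neighbour would also have
    entry at least M b and be further along. *)
Lemma QSST_le_corner (M : ST lam primed_nat) b : QSST M ->
  exists2 c : box lam, SC lam (val c) & (M b <= M c)%O.
Proof.
case=> rowM colM _ _.
case: (@arg_maxnP _ b (fun c => M b <= M c)%O
         (fun c => box_row c + box_col c)%N) => // c Mbc cmax.
exists c => //; apply/and3P; split; first exact: (valP c).
- apply/negP => inSD; pose c' : box lam := SeqSub inSD.
  have /cmax : (M b <= M c')%O.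
    by apply: le_trans Mbc _; apply: colM => //=; apply: leqnSn.
  by rewrite /box_row /box_col /= addSn ltnn.
- apply/negP => inSD; pose c' : box lam := SeqSub inSD.
  have /cmax : (M b <= M c')%O.
    by apply: le_trans Mbc _; apply: rowM => //=; apply: leqnSn.
  by rewrite /box_row /box_col /= addnS ltnn.
Qed.

Lemma normc_natcpow n (z : complex R) :
  Normc.normc (natcpow n z) = expR (complex.Re z * ln n%:R).
Proof.
rewrite /natcpow; case: z => [u v]; rewrite /cexp Normc.normcM /=.
rewrite cos2Dsin2 sqrtr1 mulr1 !mulr0 subr0 expr0n addr0 sqrtr_sqr.
by rewrite ger0_norm ?expR_ge0.
Qed.

Lemma normc_inv_weight (M : ST lam primed_nat) (s : ST lam (complex R)) :
  Normc.normc (1 / weight M s) =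
  expR (- \sum_b complex.Re (s b) * ln (pabs (M b))%:R).
Proof.
rewrite mul1r Normc.normcV expRN expR_sum; congr (_^-1).
rewrite /weight (big_morph _ (@Normc.normcM R) (@Normc.normc1 R)).
by apply: eq_bigr => b _; rewrite normc_natcpow.
Qed.

(** There are finitely many corners; the minimum starts from 1 so that it is
    positive even when the diagram is empty. *)
Lemma WQ_excess (s : ST lam (complex R)) : WQ s ->
  exists2 e : R, 0 < e & forall c : box lam, SC lam (val c) ->
    1 + e <= complex.Re (s c).
Proof.
case=> _ sC.
exists (\big[Num.min/1]_(c : box lam | SC lam (val c)) (complex.Re (s c) - 1)).
  by apply: lt_bigmin => // c /sC; rewrite subr_gt0.
by move=> c Cc; rewrite addrC -lerBrDr; apply: bigmin_le_cond.
Qed.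

(** The exponent 1 + d no longer depends on the box, which turns the sum over
    tableaux into a sum of products of identical one-variable factors. *)
Lemma QSST_majorant (s : ST lam (complex R)) : WQ s ->
  exists2 d : R, 0 < d & forall M : ST lam primed_nat, QSST M ->
    Normc.normc (1 / weight M s) <= \prod_b riemannR (1 + d) (M b).1.
Proof.
move=> Ws; have [e e0 eC] := WQ_excess s Ws.
exists (e / #|box lam|.+1%:R) => [|M QM]; first by rewrite divr_gt0 ?ltr0n.
rewrite normc_inv_weight.
under eq_bigr do rewrite riemannRE -/(pabs _).
rewrite -expR_sum ler_expR sumrN lerN2 -mulr_sumr.
apply: (@distribute_excess _ _ (fun c => SC lam (val c))) => //.
- exact: ltW.
- by move=> b; rewrite ln_ge0 // ler1n.
- move=> b; have [sN sC] := Ws.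
  by case: (boolP (SC lam (val b))) => [/sC/ltW|/sN].
- move=> b; have [c Cc /pabs_homo Mbc] := QSST_le_corner M b QM; exists c => //.
  by rewrite ler_ln ?posrE ?ltr0n // ler_nat.
Qed.

Lemma converges_absolutely_QSST_subset (D : set (ST lam primed_nat))
    (s : ST lam (complex R)) : D `<=` @QSST lam -> WQ s ->
  converges_absolutely D (fun M => 1 / weight M s).
Proof.
move=> DQ /(QSST_majorant s)[d d0 majo].
apply: (@le_lt_trans _ _
  (\esum_(M in D) (\prod_b riemannR (1 + d) (M b).1)%:E)%E).
  by apply: le_esum => M /DQ QM; rewrite lee_fin majo.
apply: (@esum_ffun_prod_lty R _ _ D
  (fun m : primed_nat => riemannR (1 + d) m.1)).
  by move=> m; rewrite ltW // riemannR_gt0 // addr_ge0 // ltW.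
exact: esum_letters_lty.
Qed.

End Tableaux.

Theorem lemma2p4 (R : realType) (lam : seq nat) (s : ST lam (complex R)) :
  strict_partition lam -> WQ s ->
  converges_absolutely (@PSST lam) (fun M => (1 / weight M s)%R) /\
  converges_absolutely (@QSST lam) (fun M => (1 / weight M s)%R).
Proof.
move=> _ Ws; split; apply: converges_absolutely_QSST_subset => //.
by move=> M [].
Qed.
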